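(* Let $\alpha\in[0,1)$, let $G$ be a strongly connected digraph with vertices $v_1,\dots,v_n$, and let $b_1,\dots,b_n$ be positive real numbers. For each $i$ put $s_i^+=\frac{\sum_{(v_i,v_j)\in E(G)}b_j^2}{b_i^2}$. Then $$\lambda_\alpha(G)\leq \max\left\{\alpha d_i^{+}+(1-\alpha)\sqrt{\sum_{(v_j,v_i)\in E(G)}s_j^+} : v_i\in V(G)\right\},$$ and if equality holds then $\alpha d_i^{+}+(1-\alpha)\sqrt{\sum_{(v_j,v_i)\in E(G)}s_j^+}$ is the same for all $1\leq i\leq n$.
   Context: Digraphs are finite, have no loops and no two arcs with the same tail and the same head (pairs of opposite arcs are allowed). For a digraph $G$ with vertex set $V(G)=\{v_1,\dots,v_n\}$ and arc set $E(G)$, $A(G)$ is the adjacency matrix, $d_i^+$ is the outdegree of $v_i$, $D(G)=\mathrm{diag}(d_1^+,\dots,d_n^+)$, $A_\alpha(G)=\alpha D(G)+(1-\alpha)A(G)$, and $\lambda_\alpha(G)$ is the eigenvalue of $A_\alpha(G)$ of largest modulus (the Perron root when $G$ is strongly connected). Strongly connected: there is a directed path from every vertex to every other vertex. *)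

(* Defs.v *)
From HB Require Import structures.
From mathcomp Require Import all_boot all_order all_algebra.
From mathcomp Require Import reals.
From mathcomp Require Export complex.

Set Implicit Arguments.
Unset Strict Implicit.
Unset Printing Implicit Defensive.

Import Order.TTheory GRing.Theory Num.Theory.

Local Open Scope ring_scope.
Local Open Scope complex_scope.

Record digraph (n : nat) := Digraph {
  arc :> rel 'I_n;
  arc_irr : irreflexive arc
}.

Definition strongly_connected (n : nat) (G : digraph n) : Prop :=
  forall i j : 'I_n, connect G i j.

Definition outdeg (n : nat) (G : digraph n) (i : 'I_n) : nat :=
  #|[set j | G i j]|.

Section Matrices.
Variables (R : realType) (n : nat).
Implicit Type G : digraph n.

Definition adj_mx G : 'M[R]_n := \matrix_(i, j) (G i j)%:R.

Definition outdeg_mx G : 'M[R]_n := diag_mx (\row_i (outdeg G i)%:R).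

Definition Aalpha (alpha : R) G : 'M[R]_n :=
  alpha *: outdeg_mx G + (1 - alpha) *: adj_mx G.

(* The modulus is compared over all complex eigenvalues.  Several eigenvalues
   may share the largest modulus (e.g. for a directed cycle with alpha = 0);
   the one meant is the nonnegative real one, i.e. the Perron root, so [lam]
   ranges over R and has to dominate every modulus (hence 0 <= lam). *)
Definition is_lambda_alpha (alpha : R) G (lam : R) : Prop :=
  let A := map_mx (real_complex R) (Aalpha alpha G) in
  eigenvalue A lam%:C /\
  (forall mu : R[i], eigenvalue A mu -> `|mu| <= lam%:C).

Definition s_plus G (b : 'I_n -> R) (i : 'I_n) : R :=
  (\sum_(j | G i j) b j ^+ 2) / b i ^+ 2.

Definition vertex_bound (alpha : R) G (b : 'I_n -> R) (i : 'I_n) : R :=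
  alpha * (outdeg G i)%:R +
  (1 - alpha) * Num.sqrt (\sum_(j | G j i) s_plus G b j).

End Matrices.

Definition max_vertex_bound (R : realType) (n : nat) (alpha : R)
    (G : digraph n.+1) (b : 'I_n.+1 -> R) : R :=
  \big[Num.max/vertex_bound alpha G b ord0]_i vertex_bound alpha G b i.

(* Main.v *)
Require Import Defs.
From HB Require Import structures.
From mathcomp Require Import all_boot all_order all_algebra.
From mathcomp Require Import reals.
From mathcomp Require Import ring.

(** Let [x] be a real right eigenvector of [Aalpha alpha G] for [lam] and
    [y i = x i / b i]. Cauchy-Schwarz applied to row [i] of the eigenvalue
    equation, with [x j = b j * y j], gives
      [(lam - alpha d_i)^2 y_i^2 <= (1 - alpha)^2 s_i \sum_(i -> j) y_j^2].
    Summing over [i] and exchanging the sums bounds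
    [\sum_i (lam - alpha d_i)^2 y_i^2] by
    [\sum_i (1 - alpha)^2 (\sum_(j -> i) s_j) y_i^2]. If [lam] is at least
    every vertex bound, the reverse inequality holds termwise, so all these
    inequalities are equalities. Equality in row [i] shows that [y i = 0]
    forces [y j = 0] for every out-neighbour [j] of [i], hence by strong
    connectivity no [y i] vanishes, and every vertex bound equals [lam]. *)

Set Implicit Arguments.
Unset Strict Implicit.
Unset Printing Implicit Defensive.

Import Order.TTheory GRing.Theory Num.Theory.

Local Open Scope ring_scope.

(** Lagrange's identity: summing [(f i * g j - f j * g i) ^+ 2] over ordered pairs gives twice the
    gap between the two sides, so the gap is nonnegative. *)
Lemma sum_mul_sqr_le (R : realDomainType) (I : finType) (P : pred I)
    (f g : I -> R) :
  (\sum_(i | P i) f i * g i) ^+ 2 <=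
  (\sum_(i | P i) f i ^+ 2) * (\sum_(i | P i) g i ^+ 2).
Proof.
set F := \sum_(i | P i) f i ^+ 2; set H := \sum_(i | P i) g i ^+ 2.
set C := \sum_(i | P i) f i * g i.
have lagrange : \sum_(i | P i) \sum_(j | P j) (f i * g j - f j * g i) ^+ 2 =
    (F * H - C ^+ 2) *+ 2.
  transitivity (\sum_(i | P i) (f i ^+ 2 * H + F * g i ^+ 2
                                - (f i * g i) * C *+ 2)).
    apply: eq_bigr => i _; rewrite !(mulr_sumr, mulr_suml) -sumrMnl.
    by rewrite -big_split -sumrB /=; apply: eq_bigr => j _; ring.
  rewrite sumrB big_split /= -mulr_suml -mulr_sumr sumrMnl -mulr_suml.
  by rewrite -/F -/H -/C; ring.
rewrite -subr_ge0 -(pmulrn_lge0 _ (ltn0Sn 1)) -lagrange.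
by apply: sumr_ge0 => i _; apply: sumr_ge0 => j _; exact: sqr_ge0.
Qed.

(** [eigenvalue] is about row vectors acting from the left; passing to the transpose yields a column
    eigenvector, whose equation at [i] sums over out-neighbours. *)
Lemma eigenvalue_trmx (F : fieldType) (n : nat) (A : 'M[F]_n) (a : F) :
  eigenvalue A^T a = eigenvalue A a.
Proof.
rewrite !eigenvalue_root_char; congr (root _ a).
rewrite /char_poly -[RHS]det_tr; congr (\det _).
by rewrite /char_poly_mx linearB /= tr_scalar_mx map_trmx.
Qed.

Lemma le_sum_eq (R : numDomainType) (I : finType) (f g : I -> R) :
    (forall i, f i <= g i) -> \sum_i g i <= \sum_i f i ->
  forall i, f i = g i.
Proof.
move=> le_fg le_sum i; apply/esym/eqP; rewrite -subr_eq0; apply/eqP.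
apply: (@psumr_eq0P _ _ xpredT (fun i => g i - f i)) => // [j _|].
  by rewrite subr_ge0.
by apply/eqP; rewrite sumrB subr_eq0 eq_le le_sum ler_sum.
Qed.

Section VertexBound.
Variables (R : realType) (n : nat) (alpha : R) (G : digraph n) (b : 'I_n -> R).
Hypotheses (halpha : 0 <= alpha < 1) (hb : forall i, 0 < b i).

Let alpha_lt1 : 0 < 1 - alpha.
Proof. by rewrite subr_gt0; case/andP: halpha. Qed.

Lemma s_plus_ge0 i : 0 <= s_plus G b i.
Proof. by rewrite divr_ge0 ?sqr_ge0 // sumr_ge0 // => j _; apply: sqr_ge0. Qed.

Lemma s_plus_gt0 i j : G i j -> 0 < s_plus G b i.
Proof.
move=> Gij; rewrite divr_gt0 ?exprn_gt0 // (bigD1 j) //=.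
by rewrite ltr_pwDl ?exprn_gt0 // sumr_ge0 // => k _; apply: sqr_ge0.
Qed.

Lemma Aalpha_eigenvector (lam : R) :
    eigenvalue (Aalpha alpha G) lam ->
  exists2 x : 'I_n -> R, exists i, x i != 0 &
    forall i, (lam - alpha * (outdeg G i)%:R) * x i =
              (1 - alpha) * \sum_(j | G i j) x j.
Proof.
rewrite -eigenvalue_trmx => /eigenvalueP[v vA v_neq0].
exists (v 0) => [|i]; first exact/rV0Pn.
have /rowP/(_ i) := vA; rewrite !mxE mulrBl => <-.
under eq_bigr => j _.
  rewrite !mxE mulrDr mulrCA [v 0 j * ((1 - alpha) * _)]mulrCA.
  over.
rewrite big_split /= -!mulr_sumr (bigD1 i) //= eqxx mulr1n.
rewrite big1 ?addr0 => [|j ji]; last by rewrite eq_sym (negbTE ji) mulr0n mulr0.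
rewrite [X in _ = _ * X]big_mkcond /=.
under [in RHS]eq_bigr => j _ do rewrite -mulrb -mulr_natr.
by ring.
Qed.

Lemma sqr_row_le (lam : R) (y : 'I_n -> R) i :
    (lam - alpha * (outdeg G i)%:R) * (b i * y i) =
      (1 - alpha) * \sum_(j | G i j) b j * y j ->
  (lam - alpha * (outdeg G i)%:R) ^+ 2 * y i ^+ 2 <=
  (1 - alpha) ^+ 2 * (s_plus G b i * \sum_(j | G i j) y j ^+ 2).
Proof.
(* Scaling by [b i ^+ 2] clears the denominator of [s_plus] and makes the left side the square of
   the row equation. *)
move=> eq_row; rewrite -(ler_pM2l (exprn_gt0 2 (hb i))).
have bi_neq0 : b i ^+ 2 != 0 by rewrite expf_neq0 // gt_eqF.
have -> : b i ^+ 2 * ((1 - alpha) ^+ 2 *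
      (s_plus G b i * \sum_(j | G i j) y j ^+ 2)) =
    (1 - alpha) ^+ 2 *
      ((\sum_(j | G i j) b j ^+ 2) * \sum_(j | G i j) y j ^+ 2).
  by rewrite mulrCA; congr (_ * _); rewrite mulrA [b i ^+ 2 * _]mulrC divfK.
rewrite mulrCA -!exprMn eq_row exprMn ler_pM2l ?exprn_gt0 //.
exact: sum_mul_sqr_le.
Qed.

(** This rigidity serves both claims: it excludes a [lam] above the maximum and settles the equality
    case. *)
Lemma vertex_bound_eq_eigenvalue (lam : R) :
    strongly_connected G -> eigenvalue (Aalpha alpha G) lam ->
    (forall i, vertex_bound alpha G b i <= lam) ->
  forall i, vertex_bound alpha G b i = lam.
Proof.
move=> hG /Aalpha_eigenvector[x [i0 xi0] eq_x] le_lam.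
pose y i := x i / b i; pose S i := \sum_(j | G j i) s_plus G b j.
pose c i := lam - alpha * (outdeg G i)%:R.
pose rhs i := (1 - alpha) ^+ 2 * (s_plus G b i * \sum_(j | G i j) y j ^+ 2).
have xE i : b i * y i = x i by rewrite mulrC divfK // gt_eqF.
have row_le i : c i ^+ 2 * y i ^+ 2 <= rhs i.
  apply: sqr_row_le; rewrite xE eq_x; congr (_ * _).
  by apply: eq_bigr => j _; rewrite xE.
have S_ge0 i : 0 <= S i by apply: sumr_ge0 => j _; apply: s_plus_ge0.
have bound_ge0 i : 0 <= (1 - alpha) * Num.sqrt (S i).
  by rewrite mulr_ge0 ?sqrtr_ge0 // ltW.
have bound_le i : (1 - alpha) * Num.sqrt (S i) <= c i.
  by rewrite lerBrDl; apply: le_lam.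
(* The sign of [c i] allows [bound_le] to be squared now and the square to be removed at the end. *)
have c_ge0 i : 0 <= c i by apply: le_trans (bound_le i).
have bound_sqr i : ((1 - alpha) * Num.sqrt (S i)) ^+ 2 <= c i ^+ 2.
  by rewrite ler_pXn2r ?nnegrE.
have sum_rhs : \sum_i rhs i =
    \sum_i ((1 - alpha) * Num.sqrt (S i)) ^+ 2 * y i ^+ 2.
  rewrite /rhs -mulr_sumr; under eq_bigr do rewrite mulr_sumr.
  rewrite (exchange_big_dep xpredT) //= mulr_sumr; apply: eq_bigr => i _.
  by rewrite [(_ * Num.sqrt _) ^+ 2]exprMn sqr_sqrtr // -[RHS]mulrA mulr_suml.
have y_le i : ((1 - alpha) * Num.sqrt (S i)) ^+ 2 * y i ^+ 2 <=
    c i ^+ 2 * y i ^+ 2 by rewrite ler_wpM2r ?sqr_ge0.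
have row_eq : forall i, c i ^+ 2 * y i ^+ 2 = rhs i.
  by apply: le_sum_eq => //; rewrite sum_rhs ler_sum.
have bound_eq : forall i, ((1 - alpha) * Num.sqrt (S i)) ^+ 2 * y i ^+ 2 =
    c i ^+ 2 * y i ^+ 2.
  by apply: le_sum_eq => //; rewrite -sum_rhs ler_sum.
(* If [y i = 0] then [rhs i = 0]; the arc makes [s_plus G b i] positive, so the sum of squares over
   out-neighbours vanishes. *)
have y_arc i j : G i j -> y i = 0 -> y j = 0.
  move=> Gij yi0; have /eqP := row_eq i.
  rewrite yi0 expr0n mulr0 eq_sym mulf_eq0 expf_eq0 /= gt_eqF //=.
  rewrite mulf_eq0 (gt_eqF (s_plus_gt0 Gij)) /= => /eqP sum0; apply/eqP.
  rewrite -sqrf_eq0; apply/eqP.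
  by apply: (psumr_eq0P _ sum0) => // k _; apply: sqr_ge0.
have y_neq0 i : y i != 0.
  (* A zero of [y] at [i] would spread along a path from [i] to [i0], where [x] is nonzero. *)
  apply: contraNneq xi0 => yi0; rewrite -xE.
  have /connectP[p Gp ->] := hG i i0.
  elim: p i yi0 Gp => [|j p IHp] i yi0 /=; first by rewrite yi0 mulr0.
  by case/andP=> Gij; apply: IHp; apply: y_arc Gij yi0.
move=> i; rewrite /vertex_bound -/(S i) -[RHS](subrKC (alpha * (outdeg G i)%:R)).
congr (_ + _); rewrite -/(c i).
apply: (pexpIrn (ltn0Sn 1)); rewrite ?nnegrE //.
exact: (mulIf (expf_neq0 2 (y_neq0 i)) (bound_eq i)).
Qed.

End VertexBound.

Unset Implicit Arguments.

Theorem theorem2p5 (R : realType) (n : nat) (alpha : R) (G : digraph n.+1)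
    (b : 'I_n.+1 -> R) (lam : R)
    (halpha : 0 <= alpha < 1)
    (hG : strongly_connected G)
    (hb : forall i, 0 < b i)
    (hlam : is_lambda_alpha alpha G lam) :
  lam <= max_vertex_bound alpha G b /\
  (lam = max_vertex_bound alpha G b ->
   forall i j, vertex_bound alpha G b i = vertex_bound alpha G b j).
Proof.
(* Since [lam] is real, being an eigenvalue of the complexified matrix descends to the real one. *)
have [+ _] := hlam; rewrite eigenvalue_map => eig_lam.
have le_max i : vertex_bound alpha G b i <= max_vertex_bound alpha G b.
  exact: le_bigmax.
have eq_lam := vertex_bound_eq_eigenvalue halpha hb hG eig_lam.
split=> [|lam_max i j]; last by rewrite !eq_lam // => k; rewrite lam_max.
(* Were [lam] above the maximum, the bound at [ord0] would equal [lam] and so exceed the maximum. *)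
rewrite leNgt; apply/negP => lt_lam; have := le_max ord0.
rewrite eq_lam ?leNgt ?lt_lam // => i.
exact: le_trans (le_max i) (ltW lt_lam).
Qed.
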